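(* The complementary prism $K_{m,n}\overline{K_{m,n}}$ of a complete bipartite graph $K_{m,n}$ exhibits perfect pair state transfer with respect to the Laplacian matrix if and only if $m=n$.
   Context: The complementary prism $G\overline{G}$ of a graph $G$ is obtained from the disjoint union of $G$ and its complement $\overline{G}$ (vertices relabelled $a'$ for $a\in V(G)$) by adding an edge between each vertex $a$ of $G$ and its copy $a'$ in $\overline{G}$. The Laplacian matrix is $L=D-A$, with $A$ the adjacency matrix and $D$ the diagonal degree matrix. For a real symmetric matrix $M$ associated with a graph, $U_M(t)=\exp(itM)$. There is perfect state transfer between two linearly independent real unit vectors $\mathbf{u},\mathbf{v}$ with respect to $M$ if there exist $\tau>0$ and $\gamma\in\mathbb{C}$ with $|\gamma|=1$ such that $U_M(\tau)\mathbf{u}=\gamma\mathbf{v}$. A pair state is a vector $\frac{1}{\sqrt2}(\mathbf{e}_x-\mathbf{e}_y)$ with $x\ne y$ vertices of the graph, where $\mathbf{e}_x$ is the characteristic vector of $x$. A graph exhibits perfect pair state transfer if there is perfect state transfer between some two (linearly independent) pair states. *)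

(* Defs.v *)
From HB Require Import structures.
From mathcomp Require Import all_boot all_order all_algebra.
From mathcomp Require Import all_classical all_reals all_analysis.
From mathcomp Require Import complex.

Set Implicit Arguments.
Unset Strict Implicit.
Unset Printing Implicit Defensive.

Import Order.TTheory GRing.Theory Num.Theory.
Import numFieldNormedType.Exports.

Local Open Scope classical_set_scope.
Local Open Scope ring_scope.
Local Open Scope complex_scope.

Record sgraph := SGraph {
  vertex :> finType;
  adj : rel vertex;
  adj_sym : symmetric adj;
  adj_irr : irreflexive adj
}.

Section Complement.
Variable G : sgraph.

Definition compl_adj : rel G := fun x y => (x != y) && ~~ adj x y.

Lemma compl_adj_sym : symmetric compl_adj.
Proof. by move=> x y; rewrite /compl_adj eq_sym adj_sym. Qed.

Lemma compl_adj_irr : irreflexive compl_adj.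
Proof. by move=> x; rewrite /compl_adj eqxx. Qed.

Definition compl_graph : sgraph := SGraph compl_adj_sym compl_adj_irr.

End Complement.

Section ComplementaryPrism.
Variable G : sgraph.

(* [inl a] is the vertex [a] of [G] and [inr a] is its copy [a'] in the
   complement. *)
Definition cprism_adj : rel (G + compl_graph G)%type := fun x y =>
  match x, y with
  | inl a, inl b => adj a b
  | inr a, inr b => adj (s := compl_graph G) a b
  | inl a, inr b => a == b
  | inr a, inl b => a == b
  end.

Lemma cprism_adj_sym : symmetric cprism_adj.
Proof.
by case=> a [] b /=; [exact: adj_sym | exact: eq_sym | exact: eq_sym
  | exact: (@adj_sym (compl_graph G))].
Qed.

Lemma cprism_adj_irr : irreflexive cprism_adj.
Proof. by case=> a; [exact: adj_irr | exact: (@adj_irr (compl_graph G))]. Qed.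

Definition cprism : sgraph := SGraph cprism_adj_sym cprism_adj_irr.

End ComplementaryPrism.

Section CompleteBipartite.
Variables m n : nat.

Definition bip_adj : rel ('I_m + 'I_n)%type := fun x y =>
  match x, y with
  | inl _, inr _ | inr _, inl _ => true
  | _, _ => false
  end.

Lemma bip_adj_sym : symmetric bip_adj.
Proof. by case=> a [] b. Qed.

Lemma bip_adj_irr : irreflexive bip_adj.
Proof. by case. Qed.

Definition complete_bipartite : sgraph := SGraph bip_adj_sym bip_adj_irr.

End CompleteBipartite.

(* Rows and columns are indexed by the vertices through [enum_val]. *)
Section GraphMatrices.
Variables (R : realType) (G : sgraph).

Definition adjacency_mx : 'M[R]_#|G| :=
  \matrix_(i, j) (adj (enum_val i) (enum_val j))%:R.

Definition degree (x : G) : nat := #|[pred y | adj x y]|.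

Definition degree_mx : 'M[R]_#|G| :=
  diag_mx (\row_i (degree (enum_val i))%:R).

Definition laplacian_mx : 'M[R]_#|G| := degree_mx - adjacency_mx.

Definition char_vec (x : G) : 'cV[R]_#|G| := \col_i (enum_val i == x)%:R.

Definition pair_state (u : 'cV[R]_#|G|) : Prop :=
  exists x y : G,
    x != y /\ u = (Num.sqrt 2)^-1 *: (char_vec x - char_vec y).

End GraphMatrices.

Section StateTransfer.
Variable R : realType.

(* Entrywise limit of the partial sums of the series of the A ^ k / k!; the
   regular module [R[i]^o] carries the topology given by the modulus. *)
Definition expmx n (A : 'M[R[i]]_n) : 'M[R[i]]_n :=
  \matrix_(i, j) limn (series (fun k => (k`!%:R^-1 *: A ^+ k) i j : R[i]^o)).

Definition to_complex_mx p q (A : 'M[R]_(p, q)) : 'M[R[i]]_(p, q) :=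
  map_mx (real_complex R) A.

Definition transition_mx n (M : 'M[R]_n) (t : R) : 'M[R[i]]_n :=
  expmx (('i * t%:C) *: to_complex_mx M).

Definition unit_vec n (u : 'cV[R]_n) : Prop := \sum_k u k 0 ^+ 2 = 1.

Definition perfect_state_transfer n (M : 'M[R]_n) (u v : 'cV[R]_n) : Prop :=
  [/\ unit_vec u, unit_vec v, free [:: u; v] &
    exists (tau : R) (gamma : R[i]), [/\ 0 < tau, `|gamma| = 1 &
      transition_mx M tau *m to_complex_mx u = gamma *: to_complex_mx v]].

Definition perfect_pair_state_transfer (G : sgraph) (M : 'M[R]_#|G|) : Prop :=
  exists u v : 'cV[R]_#|G|,
    [/\ pair_state u, pair_state v & perfect_state_transfer M u v].

End StateTransfer.

(* Main.v *)
Require Import Defs.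
From mathcomp Require Import all_boot all_order all_algebra all_reals.
From mathcomp Require Import all_classical all_analysis complex ring lra zify.

Set Implicit Arguments.
Unset Strict Implicit.
Unset Printing Implicit Defensive.

Import Order.TTheory GRing.Theory Num.Theory.
Import numFieldNormedType.Exports.

Local Open Scope ring_scope.
Local Open Scope complex_scope.
Local Open Scope classical_set_scope.

(** Let [G] have [S] vertices. If [g] is a function on [G] with sum zero and
    Laplacian eigenvalue [d], then on the complement [g] has eigenvalue
    [S - d], so the functions on the prism equal to [alpha * g] on [G] and to
    [beta * g] on its complement form a plane stable under the Laplacian, on
    which it acts by the matrix with rows [(d + 1, -1)] and [(-1, S - d + 1)].
    With [e = 2 d - S] its eigenvalues are [(S + 2 +- sqrt (e^2 + 4)) / 2].
    The two remaining eigenvalues are [0] (constants) and [2] (the function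
    [1] on [G] and [-1] on the complement).

    Suppose that transfer takes [u] to [gamma v] at time [tau], with [u] and
    [v] integral up to one common factor and of sum zero. Pairing with a real
    eigenvector [w] of eigenvalue [l] gives
    [exp (i tau l) <w, u> = gamma <w, v>] (transfer_dot), whence
    [<w, v> = +- <w, u>]. For [d] integral and [e <> 0], the root
    [sqrt (e^2 + 4)] is irrational; therefore the same sign occurs in both
    coordinates of the plane of [g], and both of its eigenvalues have phase
    [+- gamma] with that sign (signed_phases_of_transfer).

    Two such planes have the same sign: both quantities
    [tau sqrt (e^2 + 4)] and [tau sqrt (f^2 + 4)] are integral multiples
    [2 pi k] and [2 pi l]. As [e] and [f] are both congruent to [S] mod [2],
    it follows that [k] and [l] have the same parity (transfer_index_parity), so
    that the phases coincide (signed_phases_agree). When [S > 2], the state [u]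
    cannot have a component both in such a plane and along the eigenvalue [2]:
    the phases would give [tau (S - 2)] in [2 pi Z], making
    [sqrt (e^2 + 4)] rational (signed_phases_irrational_conflict). One sign thus
    governs all eigenvectors, so [v = +- u], and there is no transfer
    (no_balanced_transfer).

    For [K_{m,n}] the eigenvalues [d] are [n], [m] and [m + n], and
    [2 d <> m + n] for each of them exactly when [m <> n]. When [m = n >= 2],
    the eigenvalue [d = n] gives [e = 0]: the plane has eigenvalues [n] and
    [n + 2], and at time [pi / 2] the difference of two vertices on one side
    moves to the difference of their copies. When [m = n = 1] the prism is the
    path on four vertices, and at time [pi / sqrt 2] the difference of the ends
    of one pendant edge moves to that of the other. *)

(** * Convergence of the transition matrix *)

Section Exponential.
Variable R : realType.

Lemma normc_real (a : R) : `|a%:C| = `|a|%:C.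
Proof. by rewrite normc_def /= expr0n addr0 sqrtr_sqr. Qed.

Lemma normc_i : `|'i : R[i]| = 1.
Proof. by rewrite normc_def /= expr0n add0r expr1n sqrtr1. Qed.

Lemma cvg_complex (x y : R^nat) (a b : R) :
  x @ \oo --> a -> y @ \oo --> b ->
  ((fun k => (x k)%:C + 'i * (y k)%:C) : (R[i]^o)^nat) @ \oo
    --> (a%:C + 'i * b%:C : R[i]^o).
Proof.
move=> /cvgrPdist_lt xa /cvgrPdist_lt yb.
apply/cvgrPdist_lt => -[e e'] /[!ltcE] /= /andP[/eqP -> e0].
have e20 : 0 < e / 2 by rewrite divr_gt0.
near=> k.
have -> : a%:C + 'i * b%:C - ((x k)%:C + 'i * (y k)%:C)
    = (a - x k)%:C + 'i * (b - y k)%:C :> R[i].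
  by rewrite !rmorphB /=; ring.
apply: le_lt_trans (ler_normD _ _) _.
rewrite normrM normc_i mul1r !normc_real -rmorphD /= ltcR [ltRHS]splitr.
by rewrite ltrD//; near: k; [exact: xa | exact: yb].
Unshelve. all: by end_near. Qed.

(** The terms of the exponential series at [i x] are split into the terms of
    the cosine and sine series, so that complex convergence follows from that
    of two real series. *)
Lemma expi_coeffE (x : R) k :
  k`!%:R^-1 * ('i * x%:C) ^+ k
    = (cos_coeff x k)%:C + 'i * (sin_coeff x k)%:C :> R[i].
Proof.
have iE : ('i : R[i]) ^+ k
    = (~~ odd k)%:R * (-1) ^+ k./2 + 'i * ((odd k)%:R * (-1) ^+ k.-1./2).
  rewrite -[in LHS](odd_double_half k) exprD -mul2n exprM sqr_i.
  case: (boolP (odd k)) => ko; last by rewrite !mul1r mul0r mulr0 addr0.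
  have -> : k.-1./2 = k./2 by rewrite -{1}(odd_double_half k) ko /= doubleK.
  by rewrite expr1 mul0r add0r mul1r.
have rE (z : R) (b : bool) j : (b%:R * (-1) ^+ j * z)%:C
    = b%:R * (-1) ^+ j * z%:C :> R[i].
  by rewrite !rmorphM rmorph_nat rmorphXn rmorphN1.
rewrite /cos_coeff /sin_coeff /= exprMn iE -[_ / _ in RHS]mulrA.
rewrite -![_ * _ * _ / _]mulrA !mulrA.
rewrite -2!(mulrA _ (x ^+ k)) !rE rmorphM fmorphV rmorph_nat rmorphXn /=.
ring.
Qed.

(** The unit complex number [exp (i x)]. *)
Definition cis (x : R) : R[i] := (cos x)%:C + 'i * (sin x)%:C.

Lemma cvg_cis (x : R) :
  (series (fun k => k`!%:R^-1 * ('i * x%:C) ^+ k) : (R[i]^o)^nat) @ \oo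
    --> (cis x : R[i]^o).
Proof.
have -> : (series (fun k => k`!%:R^-1 * ('i * x%:C) ^+ k) : (R[i]^o)^nat)
    = (fun n => (series (cos_coeff x) n)%:C + 'i * (series (sin_coeff x) n)%:C).
  apply/funext => n; rewrite /series /=.
  under eq_bigr do rewrite expi_coeffE.
  by rewrite big_split /= -mulr_sumr !rmorph_sum.
apply: cvg_complex; rewrite ?cos.unlock ?sin.unlock.
  exact: is_cvg_series_cos_coeff.
exact: is_cvg_series_sin_coeff.
Qed.

(** A crude bound, independent of the entry, which is enough to compare the
    entries of the exponential series with a scalar exponential series. *)
Lemma mx_power_entry_le n (M : 'M[R]_n) i j k :
  `|(M ^+ k) i j| <= (\sum_p \sum_q `|M p q|) ^+ k.
Proof.
set c := (\sum_p _); elim: k i j => [|k IH] i j.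
  by rewrite !expr0 mxE; case: eqP => _; rewrite ?normr1 ?normr0 ?ler01.
rewrite !exprS mxE; apply: le_trans (ler_norm_sum _ _ _) _.
have c0 : 0 <= c by do 2!(apply: sumr_ge0 => ? _).
apply: (@le_trans _ _ (\sum_q (`|M i q| * c ^+ k))).
  by apply: ler_sum => q _; rewrite normrM ler_wpM2l.
rewrite -mulr_suml ler_wpM2r ?exprn_ge0// /c [leRHS](bigD1 i)//= lerDl.
by do 2!(apply: sumr_ge0 => ? _).
Qed.

(** The entries of [transition_mx] are defined as limits, and a limit carries
    information only once the series is known to converge. *)
Lemma cvg_transition_mx n (M : 'M[R]_n) (t : R) i j :
  (series (fun k => (k`!%:R^-1 *: (('i * t%:C) *: to_complex_mx M) ^+ k) i j)
    : (R[i]^o)^nat) @ \oo --> (transition_mx M t i j : R[i]^o).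
Proof.
rewrite [X in _ --> X]mxE.
set c := \sum_p \sum_q `|M p q|.
have c0 : 0 <= c by do 2!(apply: sumr_ge0 => ? _).
have coeff_le (b : bool) l k :
    `|b%:R * (-1) ^+ l * t ^+ k / k`!%:R| <= `|t| ^+ k / k`!%:R.
  rewrite 3!normrM normrX normrN1 expr1n mulr1 normfV normrX !normr_nat.
  by rewrite -mulrA ler_piMl ?mulr_ge0 ?exprn_ge0// lern1; case: b.
have sc (f : R^nat) : (forall k, `|f k| <= `|t| ^+ k / k`!%:R) ->
    cvg (series (fun k => f k * (M ^+ k) i j) @ \oo).
  move=> fle; apply: normed_cvg.
  apply: (@series_le_cvg _ _ (exp_coeff (c * `|t|))) => [k|k|k|].
  - exact: normr_ge0.
  - by rewrite exp_coeff_ge0// mulr_ge0.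
  - rewrite /= normrM /exp_coeff /= exprMn mulrC -mulrA ler_pM//.
    exact: mx_power_entry_le.
  - exact: is_cvg_series_exp_coeff.
have -> : (series (fun k =>
      (k`!%:R^-1 *: (('i * t%:C) *: to_complex_mx M) ^+ k) i j) : (R[i]^o)^nat)
    = (fun N => (series (fun k => cos_coeff t k * (M ^+ k) i j) N)%:C
        + 'i * (series (fun k => sin_coeff t k * (M ^+ k) i j) N)%:C).
  apply/funext => N; rewrite /series /=.
  rewrite !rmorph_sum mulr_sumr -big_split /=; apply: eq_bigr => k _.
  have XE : (('i * t%:C) *: to_complex_mx M) ^+ k
      = ('i * t%:C) ^+ k *: to_complex_mx (M ^+ k).
    elim: k => [|k IH]; first by rewrite !expr0 scale1r /to_complex_mx map_mx1.
    rewrite [LHS]exprS IH -[LHS]/(_ *m _) -scalemxAl -scalemxAr scalerA.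
    by rewrite -map_mxM -[M *m _]/(M * _) -!exprS.
  rewrite XE !mxE mulrA expi_coeffE !rmorphM /=; ring.
have cv (f : R^nat) : (forall k, `|f k| <= `|t| ^+ k / k`!%:R) ->
    exists a : R, series (fun k => f k * (M ^+ k) i j) @ \oo --> a.
  by move=> /sc h; exists (limn (series (fun k => f k * (M ^+ k) i j))).
have [a ha] : exists a : R,
    series (fun k => cos_coeff t k * (M ^+ k) i j) @ \oo --> a.
  by apply: cv => k; exact: coeff_le.
have [b hb] : exists b : R,
    series (fun k => sin_coeff t k * (M ^+ k) i j) @ \oo --> b.
  by apply: cv => k; exact: coeff_le.
exact: (cvgP _ (cvg_complex ha hb)).
Qed.

(** Both sides are the limit of the same series: a power of [M] acts on an
    eigenvector as a power of the eigenvalue. *)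
Lemma transition_mx_eigen n (M : 'M[R]_n) (t l : R) (w : 'cV[R]_n) :
  M *m w = l *: w ->
  transition_mx M t *m to_complex_mx w = cis (t * l) *: to_complex_mx w.
Proof.
move=> Mw; apply/matrixP => i j.
rewrite [RHS]mxE [LHS]mxE [to_complex_mx w i j]mxE.
pose A := ('i * t%:C) *: to_complex_mx M.
pose f q (k : nat) : R[i]^o := (k`!%:R^-1 *: A ^+ k) i q.
have A1 : A *m to_complex_mx w = ('i * (t * l)%:C) *: to_complex_mx w.
  by rewrite -scalemxAl -map_mxM Mw map_mxZ scalerA rmorphM mulrA.
have Aw k : A ^+ k *m to_complex_mx w
    = ('i * (t * l)%:C) ^+ k *: to_complex_mx w.
  elim: k => [|k IH]; first by rewrite !expr0 scale1r mul1mx.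
  by rewrite exprSr -[_ * A]/(_ *m A) -mulmxA A1 -scalemxAr IH scalerA exprS.
have lhs : (fun N => \sum_q series (f q) N * (w q j)%:C : R[i]^o) @ \oo
    --> (\sum_q transition_mx M t i q * (w q j)%:C : R[i]^o).
  apply: cvg_big => [|q _]; first exact: add_continuous.
  by apply: cvgMr_tmp; exact: cvg_transition_mx.
have rhs : (fun N => \sum_q series (f q) N * (w q j)%:C : R[i]^o) @ \oo
    --> (cis (t * l) * (w i j)%:C : R[i]^o).
  have -> : (fun N => \sum_q series (f q) N * (w q j)%:C : R[i]^o)
      = (fun N => series (fun k => k`!%:R^-1 * ('i * (t * l)%:C) ^+ k) N
                  * (w i j)%:C : R[i]^o).
    apply/funext => N; rewrite /series /=.
    under eq_bigr do rewrite mulr_suml.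
    rewrite exchange_big mulr_suml; apply: eq_bigr => k _.
    have /matrixP/(_ i j) := Aw k; rewrite !mxE => AwE.
    rewrite -mulrA -AwE mulr_sumr.
    by apply: eq_bigr => q _; rewrite /f !mxE mulrA.
  by apply: cvgMr_tmp; exact: cvg_cis.
under eq_bigr do rewrite [to_complex_mx w _ j]mxE.
exact: (norm_cvg_unique lhs rhs).
Qed.

Lemma trmx_exp n (A : 'M[R[i]]_n) k : (A ^+ k)^T = A^T ^+ k.
Proof.
elim: k => [|k IH]; first by rewrite !expr0 trmx1.
by rewrite exprS exprSr -IH -[LHS]/((A *m A ^+ k)^T) trmx_mul.
Qed.

Lemma transition_mx_tr n (M : 'M[R]_n) t :
  (transition_mx M t)^T = transition_mx M^T t.
Proof.
have AT : ('i * t%:C) *: to_complex_mx M^T = (('i * t%:C) *: to_complex_mx M)^T.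
  by rewrite linearZ /= /to_complex_mx map_trmx.
rewrite /transition_mx AT; set A := _ *: _.
apply/matrixP => i j; rewrite [LHS]mxE [LHS]mxE [RHS]mxE.
suff -> : (fun k => (k`!%:R^-1 *: A ^+ k) j i : R[i]^o)
    = (fun k => (k`!%:R^-1 *: A^T ^+ k) i j : R[i]^o) by [].
by apply/funext => k; rewrite -trmx_exp -linearZ /= [RHS]mxE.
Qed.

End Exponential.

(** * Integers of the form e^2 + 4 *)

Lemma sqr_add4_sqr (e r : int) : e ^+ 2 + 4 = r ^+ 2 -> e = 0.
Proof.
have [a [-> | ->]] : exists a : nat, e = a \/ e = - a%:Z by exists `|e|%N; lia.
all: have [b [-> | ->]] : exists b : nat, r = b \/ r = - b%:Z
       by exists `|r|%N; lia.
all: rewrite ?sqrrN => E.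
all: suff : a = 0%N by move=> ->.
all: have {}E : (a * a + 4 = b * b)%N by lia.
(* beyond [a + 1], the square [b^2] is at least [(a + 2)^2 = a^2 + 4 a + 4] *)
all: have [ab|ab|ab] := ltngtP b a.+1; nia.
Qed.

(** Modulo [16]: if [k] is odd and [l] is even, then for [e] and [f] odd the two
    sides differ in parity, and for [e] and [f] even the left side is [4] or [8]
    whereas the right side is [0]. *)
Lemma transfer_index_parity (e f k l : int) : (2 %| e - f)%Z ->
  k ^+ 2 * (f ^+ 2 + 4) = l ^+ 2 * (e ^+ 2 + 4) -> (2 %| k - l)%Z.
Proof.
have par (z : int) : exists y : int, z = 2 * y \/ z = 2 * y + 1.
  by exists (z %/ 2)%Z; lia.
have [e' e2] := par e; have [f' f2] := par f; have [k' k2] := par k.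
have [l' l2] := par l.
have [f'' f3] := par f'; have [e'' e3] := par e'.
rewrite !expr2.
case: e2 f2 k2 l2 => -> [] -> [] -> [] ->; try lia.
all: case: e3 => ->; case: f3 => ->; lia.
Qed.

(** * Phases *)

Section Phases.
Variable R : realType.
Implicit Types x y t : R.

Lemma cisD x y : cis (x + y) = cis x * cis y.
Proof.
apply/eqP; rewrite eq_complex /cis cosD sinD /=.
by apply/andP; split; apply/eqP; ring.
Qed.

Lemma cis0 : cis (0 : R) = 1.
Proof. by rewrite /cis cos0 sin0 mulr0 addr0. Qed.

Lemma cispi : cis (pi : R) = -1.
Proof. by rewrite /cis cospi sinpi mulr0 addr0 rmorphN1. Qed.

Lemma norm_cis x : `|cis x| = 1.
Proof.
by rewrite normc_def /cis /=; simpc; rewrite cos2Dsin2 sqrtr1.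
Qed.

Lemma cis_neq0 x : cis x != 0.
Proof. by rewrite -normr_eq0 norm_cis oner_eq0. Qed.

Lemma cis_2pi_int (k : int) : cis (k%:~R * (pi *+ 2) : R) = 1.
Proof.
have nat_case (n : nat) : cis (n%:R * (pi *+ 2) : R) = 1.
  elim: n => [|n IH]; first by rewrite mul0r cis0.
  by rewrite -natr1 mulrDl mul1r cisD IH mul1r mulr2n cisD cispi mulrNN mulr1.
case: k => n; first exact: nat_case.
rewrite NegzE rmorphN /= mulNr.
apply: (mulIf (cis_neq0 (n.+1%:R * (pi *+ 2)))).
by rewrite -cisD addNr cis0 nat_case mulr1.
Qed.

Lemma cis_eq1 x : cis x = 1 -> exists k : int, x = k%:~R * (pi *+ 2).
Proof.
move=> x1.
have p0 : 0 < pi *+ 2 :> R by rewrite mulrn_wgt0// pi_gt0.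
(* [k] is the integer nearest to [x / 2 pi], so that [y] lies in [-pi, pi] *)
pose k := Num.floor (x / (pi *+ 2) + 1 / 2); exists k.
pose y := x - k%:~R * (pi *+ 2).
have y1 : cos y = 1.
  have : cis y = 1.
    have := cis_2pi_int (- k); rewrite rmorphN /= mulNr => e.
    by rewrite /y cisD x1 e mulr1.
  by rewrite /cis => /(congr1 (@complex.Re R)) /=; simpc.
have /andP[lo hi] : - pi <= y <= pi.
  have := floor_itv (x / (pi *+ 2) + 1 / 2); rewrite -/k.
  have xE : x = x / (pi *+ 2) * (pi *+ 2) by rewrite divfK// gt_eqF.
  move: xE; set r := x / _ => xE; rewrite rmorphD /= => /andP[lo hi].
  have -> : y = (r - k%:~R) * (pi *+ 2) by rewrite /y {1}xE mulrBl.
  have := pi_gt0 R; move=> ppos; rewrite mulr2n; apply/andP; split; nra.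
have /cos_inj : cos `|y| = cos 0 by rewrite cos_norm cos0.
rewrite !in_itv /= normr_ge0 lexx pi_ge0 ler_norml lo hi => /(_ isT isT).
by move/eqP; rewrite normr_eq0 subr_eq0 => /eqP.
Qed.

Definition discr_root (e : int) : R := Num.sqrt (e ^+ 2 + 4)%:~R.

Lemma discr_rootK e : discr_root e ^+ 2 = (e ^+ 2 + 4)%:~R.
Proof. by rewrite sqr_sqrtr// ler0z addr_ge0// sqr_ge0. Qed.

(** A rational square root of the integer [e^2 + 4] is an integer, and
    [e^2 + 4] is a square only for [e = 0]. *)
Lemma discr_root_irrational e (p q : int) : e != 0 ->
  p%:~R + q%:~R * discr_root e = 0 -> p = 0 /\ q = 0.
Proof.
move=> e0 pq.
have E : p ^+ 2 = q ^+ 2 * (e ^+ 2 + 4).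
  have: (p%:~R : R) ^+ 2 = q%:~R ^+ 2 * (e ^+ 2 + 4)%:~R.
    by rewrite -discr_rootK -exprMn -sqrrN; congr (_ ^+ 2); lra.
  by move=> /eqP; rewrite -!rmorphXn -rmorphM eqr_int => /eqP.
have q0 : q = 0.
  apply/eqP; apply: contraT => q0.
  have : (q %| p)%Z.
    have : (`|q| ^ 2 %| `|p| ^ 2)%N by rewrite -!abszX E abszM dvdn_mulr.
    by rewrite dvdn_pexp2r.
  case/dvdzP => r pr; move: E; rewrite pr exprMn mulrC.
  by move/(mulfI (expf_neq0 2 q0))/esym/sqr_add4_sqr/eqP; rewrite (negPf e0).
by move: pq; rewrite q0 mul0r addr0 => /eqP; rewrite intr_eq0 => /eqP.
Qed.

Lemma cis_half_eq x : cis (x / 2) = cis (- x / 2) ->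
  exists k : int, x = k%:~R * (pi *+ 2).
Proof.
move=> h; apply: cis_eq1.
have -> : x = x / 2 + x / 2 by lra.
by rewrite cisD {1}h -cisD mulNr addNr cis0.
Qed.

(** The two eigenvalues of the prism that come from an eigenvalue [d] of a graph
    on [S] vertices, with [e = 2 d - S], both have phase [gamma] up to the
    sign recorded by [b]. *)
Definition signed_phases (S : int) (tau : R) (gamma : R[i]) (e : int)
    (b : bool) : Prop :=
  cis (tau * (((S + 2)%:~R + discr_root e) / 2)) = (-1) ^+ b * gamma /\
  cis (tau * (((S + 2)%:~R - discr_root e) / 2)) = (-1) ^+ b * gamma.

(** The two eigenvalues differ by [sqrt (e^2 + 4)] and have the same phase. *)
Lemma signed_phases_period S tau gamma e b : signed_phases S tau gamma e b ->
  exists k : int, tau * discr_root e = k%:~R * (pi *+ 2).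
Proof.
case=> p m; apply: cis_half_eq.
apply: (mulfI (cis_neq0 (tau * (S + 2)%:~R / 2))).
rewrite -!cisD; move: p; rewrite -m.
set a := _%:~R; set s := discr_root e => {}p.
have -> : tau * a / 2 + tau * s / 2 = tau * ((a + s) / 2) by lra.
by rewrite p; congr cis; lra.
Qed.

(** Up to the common factor [exp (i tau (S + 2) / 2)], the phases are
    [exp (i pi k)] and [exp (i pi l)] with [k] and [l] of the same parity. *)
Lemma signed_phases_agree S tau gamma e f b c : 0 < tau -> gamma != 0 ->
  (2 %| e - f)%Z ->
  signed_phases S tau gamma e b -> signed_phases S tau gamma f c -> b = c.
Proof.
move=> t0 g0 ef pe pf.
have [k ek] := signed_phases_period pe; have [l fl] := signed_phases_period pf.
have pp : pi *+ 2 != 0 :> R by rewrite mulrn_eq0/= gt_eqF// pi_gt0.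
have E : k ^+ 2 * (f ^+ 2 + 4) = l ^+ 2 * (e ^+ 2 + 4).
  have E1 : k%:~R * discr_root f = l%:~R * discr_root e.
    by apply: (mulIf pp); rewrite [LHS]mulrAC -ek [RHS]mulrAC -fl; ring.
  have : (k%:~R ^+ 2 * (f ^+ 2 + 4)%:~R : R) = l%:~R ^+ 2 * (e ^+ 2 + 4)%:~R.
    by rewrite -!discr_rootK -!exprMn E1.
  by move=> /eqP; rewrite -!rmorphXn -!rmorphM eqr_int => /eqP.
have /dvdzP[j kl] := transfer_index_parity ef E.
case: pe pf => pe _ [pf _].
have : cis (tau * (((S + 2)%:~R + discr_root e) / 2))
     = cis (tau * (((S + 2)%:~R + discr_root f) / 2)).
  have -> : tau * (((S + 2)%:~R + discr_root e) / 2)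
      = tau * (((S + 2)%:~R + discr_root f) / 2) + j%:~R * (pi *+ 2).
    have : tau * discr_root e - tau * discr_root f = 2 * (j%:~R * (pi *+ 2)).
      rewrite ek fl -mulrBl -rmorphB kl rmorphM /=; ring.
    by move=> h; lra.
  by rewrite cisD cis_2pi_int mulr1.
rewrite pe pf => /(mulIf g0) /eqP; rewrite -subr_eq0.
case: b c {pe pf} => -[]//=; rewrite ?expr0 ?expr1.
  by rewrite -opprD oppr_eq0 paddr_eq0 ?oner_eq0// ler01.
by rewrite opprK paddr_eq0 ?oner_eq0// ler01.
Qed.

(** The eigenvalues of [signed_phases] have sum [S + 2], so their phases
    multiply to [gamma^2], which is also the square of the phase of the
    eigenvalue [2]. Hence [tau (S - 2)] is a multiple of [2 pi], and so is
    [tau sqrt (e^2 + 4)]: their ratio would be rational. *)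
Lemma signed_phases_irrational_conflict S tau gamma e (b c : bool) : 0 < tau ->
  2 < S -> e != 0 -> signed_phases S tau gamma e b ->
  cis (tau * 2) = (-1) ^+ c * gamma -> False.
Proof.
move=> t0 S2 e0 pe p2.
have [k ek] := signed_phases_period pe.
have [j hj] : exists j : int, tau * (S - 2)%:~R = j%:~R * (pi *+ 2).
  apply: cis_eq1; apply: (mulIf (cis_neq0 (tau * 2 + tau * 2))).
  rewrite -cisD mul1r [RHS]cisD p2.
  have -> : tau * (S - 2)%:~R + (tau * 2 + tau * 2) =
    tau * (((S + 2)%:~R + discr_root e) / 2)
      + tau * (((S + 2)%:~R - discr_root e) / 2).
    by rewrite rmorphB rmorphD /=; lra.
  by rewrite cisD pe.1 pe.2 !(mulrACA _ gamma) -!signr_addb !addbb.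
have pp : pi *+ 2 != 0 :> R by rewrite mulrn_eq0/= gt_eqF// pi_gt0.
have /(discr_root_irrational e0)[] :
    (k * (S - 2))%:~R + (- j)%:~R * discr_root e = 0 :> R.
  apply: (mulIf pp); rewrite rmorphM rmorphN /= mul0r.
  transitivity (k%:~R * (pi *+ 2) * (S - 2)%:~R
    - j%:~R * (pi *+ 2) * discr_root e : R); first by ring.
  by rewrite -ek -hj; ring.
move=> _ /eqP; rewrite oppr_eq0 => /eqP j0.
move: hj; rewrite j0 mul0r => /eqP.
by rewrite mulf_eq0 gt_eqF//= intr_eq0 subr_eq0 gt_eqF.
Qed.

(** Here [p, q] and [p', q'] are the pairings of [u] and [v] with the two copies
    of a function [g], and [(e -+ sqrt (e^2 + 4)) / 2] is the weight of the
    second copy in the eigenvectors. Taking moduli gives an equality up to sign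
    between real numbers of the form [rational + rational * sqrt (e^2 + 4)], so
    irrationality yields the equality of both coordinates with one sign. *)
Lemma signed_phases_of_transfer S tau gamma e (p q p' q' : int) :
  `|gamma| = 1 -> e != 0 ->
  cis (tau * (((S + 2)%:~R + discr_root e) / 2))
      * (p%:~R + (e%:~R - discr_root e) / 2 * q%:~R)%:C
    = gamma * (p'%:~R + (e%:~R - discr_root e) / 2 * q'%:~R)%:C ->
  cis (tau * (((S + 2)%:~R - discr_root e) / 2))
      * (p%:~R + (e%:~R + discr_root e) / 2 * q%:~R)%:C
    = gamma * (p'%:~R + (e%:~R + discr_root e) / 2 * q'%:~R)%:C ->
  exists b : bool, [/\ p' = (-1) ^+ b * p, q' = (-1) ^+ b * q &
    p = 0 /\ q = 0 \/ signed_phases S tau gamma e b].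
Proof.
move=> g1 e0 hp hm; set s := discr_root e.
have irr (a c : int) : a%:~R + c%:~R * s = 0 -> a = 0 /\ c = 0.
  exact: discr_root_irrational.
have g0 : gamma != 0 by rewrite -normr_eq0 g1 oner_eq0.
have [b hb] : exists b : bool, p'%:~R + (e%:~R - s) / 2 * q'%:~R
    = (-1) ^+ b * (p%:~R + (e%:~R - s) / 2 * q%:~R) :> R.
  have /(congr1 Num.norm) := hp.
  rewrite !normrM norm_cis g1 !mul1r !normc_real => /complexI /esym /eqP.
  rewrite eqr_norm2 => /orP[] /eqP ->; [exists false|exists true].
    by rewrite mul1r.
  by rewrite mulN1r.
have [ep eq] : p' = (-1) ^+ b * p /\ q' = (-1) ^+ b * q.
  have signE (z : int) : ((-1) ^+ b * z)%:~R = (-1) ^+ b * z%:~R :> R.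
    by rewrite rmorphM rmorph_sign.
  have /irr[h1 h2] : (2 * (p' - (-1) ^+ b * p) + e * (q' - (-1) ^+ b * q))%:~R
      + (- (q' - (-1) ^+ b * q))%:~R * s = 0.
    rewrite rmorphN rmorphD /= !rmorphM !rmorphB /= !signE.
    by move: hb; set z := (-1) ^+ b => hb; lra.
  by case: b {hb signE} h1 h2; rewrite ?expr0 ?expr1; lia.
exists b; split=> //.
have [?|npq] := pselect (p = 0 /\ q = 0); [by left | right].
have nz (r : R) : r = s \/ r = - s ->
    (p%:~R + (e%:~R + r) / 2 * q%:~R)%:C != 0 :> R[i].
  move=> rE; apply/eqP => /complexI h; apply: npq.
  have [] : 2 * p + e * q = 0 /\ q = 0.
    case: rE h => -> h.
      by apply: irr; rewrite rmorphD !rmorphM /=; lra.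
    have [] : 2 * p + e * q = 0 /\ - q = 0.
      by apply: irr; rewrite rmorphN rmorphD !rmorphM /=; lra.
    by lia.
  by lia.
have scale (r : R) : p'%:~R + r * q'%:~R = (-1) ^+ b * (p%:~R + r * q%:~R).
  by rewrite ep eq !rmorphM !rmorph_sign /=; ring.
split.
  apply: (mulIf (nz (- s) (or_intror erefl))).
  by rewrite hp scale rmorphM rmorph_sign /=; ring.
apply: (mulIf (nz s (or_introl erefl))).
by rewrite hm scale rmorphM rmorph_sign /=; ring.
Qed.

End Phases.

(** * The Laplacian on functions of the vertices *)

Section VertexFunctions.
Variable G : sgraph.

(** The coefficients vary because the irrationality argument rests on integral
    eigenfunctions, while the states live over the reals. *)
Definition lap (V : pzRingType) (f : G -> V) (x : G) : V :=
  \sum_y (adj x y)%:R * (f x - f y).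

Lemma lap_intr (V : pzRingType) (f : G -> int) x :
  lap (fun y => (f y)%:~R : V) x = (lap f x)%:~R.
Proof.
rewrite /lap rmorph_sum; apply: eq_bigr => y _.
by rewrite rmorphM rmorph_nat rmorphB.
Qed.

Variable R : realType.

Definition vertex_col (f : G -> R) : 'cV[R]_#|G| := \col_i f (enum_val i).

Lemma sum_enum_val (f : G -> R) : \sum_x f x = \sum_(k < #|G|) f (enum_val k).
Proof. by rewrite -big_enum_val. Qed.

Lemma laplacian_mx_vertex_col f :
  laplacian_mx R G *m vertex_col f = vertex_col (lap f).
Proof.
apply/matrixP => i j; rewrite mxE [RHS]mxE /lap.
under [RHS]eq_bigr do rewrite mulrBr.
rewrite sumrB -mulr_suml [X in _ - X]sum_enum_val.
under eq_bigr do rewrite mxE mulrDl.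
rewrite big_split /=; congr (_ + _).
  rewrite (bigD1 i)//= big1 ?addr0; last first.
    by move=> k ki; rewrite !mxE eq_sym (negPf ki) mulr0n mul0r.
  rewrite !mxE eqxx mulr1n; congr (_ * _).
  rewrite /degree -sum1_card big_mkcond natr_sum.
  by apply: eq_bigr => y _; rewrite inE; case: adj.
rewrite -sumrN; apply: eq_bigr => k _.
by rewrite !mxE mulNr.
Qed.

Lemma laplacian_mx_sym : (laplacian_mx R G)^T = laplacian_mx R G.
Proof.
rewrite /laplacian_mx linearB /= /degree_mx tr_diag_mx; congr (_ - _).
by apply/matrixP => i j; rewrite !mxE adj_sym.
Qed.

Lemma vertex_col_dot f g :
  (vertex_col f)^T *m vertex_col g = (\sum_x f x * g x)%:M.
Proof.
apply/matrixP => i j; rewrite !mxE (ord1 i) (ord1 j) eqxx mulr1n.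
by rewrite sum_enum_val; apply: eq_bigr => k _; rewrite !mxE.
Qed.

(** The Laplacian is symmetric, so pairing with an eigenvector [w] commutes with
    the evolution up to the phase of [w]. *)
Lemma transfer_dot (t l c : R) (gamma : R[i]) (w u v : G -> R) :
  c != 0 -> (forall x, lap w x = l * w x) ->
  transition_mx (laplacian_mx R G) t *m to_complex_mx (c *: vertex_col u)
    = gamma *: to_complex_mx (c *: vertex_col v) ->
  cis (t * l) * (\sum_x w x * u x)%:C = gamma * (\sum_x w x * v x)%:C.
Proof.
move=> c0 lw; set M := laplacian_mx R G => U.
have Mw : M *m vertex_col w = l *: vertex_col w.
  rewrite laplacian_mx_vertex_col; apply/matrixP => i j.
  by rewrite !mxE lw.
have dot (z : G -> R) : (to_complex_mx (vertex_col w))^T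
    *m to_complex_mx (c *: vertex_col z) = (c%:C * (\sum_x w x * z x)%:C)%:M.
  rewrite /to_complex_mx map_mxZ -scalemxAr map_trmx -map_mxM vertex_col_dot.
  by rewrite map_scalar_mx scale_scalar_mx.
have : cis (t * l) *: ((to_complex_mx (vertex_col w))^T
      *m to_complex_mx (c *: vertex_col u))
    = gamma *: ((to_complex_mx (vertex_col w))^T
      *m to_complex_mx (c *: vertex_col v)).
  rewrite [RHS]scalemxAr -U mulmxA [LHS]scalemxAl -linearZ /=.
  rewrite -(transition_mx_eigen t Mw) trmx_mul transition_mx_tr.
  by rewrite laplacian_mx_sym.
rewrite !dot !scale_scalar_mx => /matrixP/(_ 0 0); rewrite !mxE !mulr1n.
rewrite (mulrCA (cis _)) (mulrCA gamma); apply: mulfI.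
by apply/eqP => /complexI/eqP; rewrite (negPf c0).
Qed.

End VertexFunctions.

(** * Spectrum of the complementary prism *)

Section Prism.
Variable G : sgraph.

Definition prism_fun (V : Type) (f g : G -> V) (z : cprism G) : V :=
  match z with inl a => f a | inr a => g a end.

Lemma sum_cprism (V : nmodType) (F : cprism G -> V) :
  \sum_z F z = \sum_(a : G) F (inl a) + \sum_(a : G) F (inr a).
Proof. by rewrite big_sumType. Qed.

Lemma lap_cprism_inl (V : pzRingType) (f g : G -> V) a :
  lap (prism_fun f g) (inl a) = lap f a + (f a - g a).
Proof.
rewrite /lap sum_cprism /=; congr (_ + _).
rewrite (bigD1 a)//= eqxx mul1r big1 ?addr0// => b ba.
by rewrite eq_sym (negPf ba) mul0r.
Qed.

Lemma lap_cprism_inr (V : pzRingType) (f g : G -> V) a :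
  lap (prism_fun f g) (inr a)
  = g a *+ #|G| - \sum_b g b - lap g a + (g a - f a).
Proof.
rewrite /lap sum_cprism /= addrC; congr (_ + _); last first.
  rewrite (bigD1 a)//= eqxx mul1r big1 ?addr0// => b ba.
  by rewrite eq_sym (negPf ba) mul0r.
(* adjacency in [G] and in its complement add up to [1] off the diagonal *)
apply/eqP; rewrite eq_sym subr_eq -big_split /=.
rewrite -sumr_const -sumrB; apply/eqP; apply: eq_bigr => b _.
rewrite /compl_adj; have [<-|ab] /= := eqVneq.
  by rewrite subrr !mulr0 addr0.
by case: adj; rewrite ?mul1r ?mul0r ?addr0 ?add0r.
Qed.

Lemma lap_cprism_const (R : comPzRingType) z :
  lap (prism_fun (fun=> 1) (fun=> -1) : cprism G -> R) z
    = 2 * prism_fun (fun=> 1) (fun=> -1) z.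
Proof.
have lap0 (c : R) a : lap (fun=> c : R) a = 0 :> R.
  by rewrite /lap big1// => b _; rewrite subrr mulr0.
case: z => a; rewrite ?lap_cprism_inl ?lap_cprism_inr lap0 /=; first by ring.
by rewrite sumr_const subrr; ring.
Qed.

(** The hypotheses on [b] and [l] say that [(1, b)] is an eigenvector, of
    eigenvalue [l], of the matrix with rows [(d + 1, -1)] and
    [(-1, #|G| - d + 1)]. *)
Lemma lap_cprism_eigen (F : fieldType) (g : G -> F) (d b l : F) :
  \sum_x g x = 0 -> (forall x, lap g x = d * g x) ->
  l = d + 1 - b -> l * b = (#|G|%:R + 1 - d) * b - 1 ->
  forall z, lap (prism_fun g (fun x => b * g x)) z
    = l * prism_fun g (fun x => b * g x) z.
Proof.
move=> g0 gd lE lbE [] a; rewrite ?lap_cprism_inl ?lap_cprism_inr /=.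
  by rewrite gd lE; ring.
have -> : lap (fun x => b * g x) a = b * (d * g a).
  by rewrite -gd /lap mulr_sumr; apply: eq_bigr => c _; ring.
rewrite -mulr_sumr g0 mulr0 subr0 [RHS]mulrA lbE -mulr_natl; ring.
Qed.

End Prism.

(** * Obstruction to transfer *)

(** The family stands for the integral eigenfunctions of sum zero of [G],
    together with an integral eigenvalue: [family_complete] says that it spans
    the orthogonal complement of the constants. An eigenvalue [#|G| / 2] has to
    be excluded because it gives transfer (half_eigenvalue_swap below). *)
Section NoTransfer.
Variables (R : realType) (G : sgraph).
Variable eigen_family : (G -> int) -> int -> Prop.
Hypothesis family_sum0 : forall g d, eigen_family g d -> \sum_a g a = 0.
Hypothesis family_eigen : forall g d, eigen_family g d ->
  forall a, lap g a = d * g a.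
Hypothesis family_not_half : forall g d, eigen_family g d -> 2 * d != #|G|.
Hypothesis family_complete : forall z : G -> int,
  (forall g d, eigen_family g d -> \sum_a g a * z a = 0) ->
  exists c, forall a, z a = c.
Hypothesis G_big : (2 < #|G|)%N.

Local Notation S := (#|G|%:Z).

Section Phase.
Variables (x y : cprism G -> int) (c : R) (tau : R) (gamma : R[i]).
Hypothesis c0 : c != 0.
Hypothesis g1 : `|gamma| = 1.
Hypothesis transfer :
  transition_mx (laplacian_mx R (cprism G)) tau
    *m to_complex_mx (c *: vertex_col (fun z => (x z)%:~R))
  = gamma *: to_complex_mx (c *: vertex_col (fun z => (y z)%:~R)).

Lemma family_transfer g d : eigen_family g d ->
  let e := 2 * d - S in
  exists b : bool,
   [/\ \sum_a g a * y (inl a) = (-1) ^+ b * \sum_a g a * x (inl a),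
       \sum_a g a * y (inr a) = (-1) ^+ b * \sum_a g a * x (inr a) &
       (\sum_a g a * x (inl a) = 0 /\ \sum_a g a * x (inr a) = 0) \/
       signed_phases S tau gamma e b].
Proof.
move=> gd e.
have e0 : e != 0 by rewrite subr_eq0 (family_not_half gd).
have gd0 := family_sum0 gd; have gdE := family_eigen gd.
pose gR a : R := (g a)%:~R.
have gR0 : \sum_a gR a = 0 by rewrite -rmorph_sum gd0.
have gRE a : lap gR a = d%:~R * gR a by rewrite lap_intr gdE rmorphM.
have dotE (r : R) (z : cprism G -> int) :
    \sum_w prism_fun gR (fun a => r * gR a) w * (z w)%:~R
    = (\sum_a g a * z (inl a))%:~R + r * (\sum_a g a * z (inr a))%:~R.
  rewrite sum_cprism /= !rmorph_sum mulr_sumr; congr (_ + _).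
    by apply: eq_bigr => a _; rewrite rmorphM.
  by apply: eq_bigr => a _; rewrite rmorphM mulrA.
have rootK : discr_root R e * discr_root R e = e%:~R * e%:~R + 4.
  by rewrite -expr2 discr_rootK rmorphD rmorphXn.
have eE : (e%:~R : R) = 2 * d%:~R - #|G|%:R.
  by rewrite /e rmorphB rmorphM.
apply: signed_phases_of_transfer => //.
  rewrite -!dotE; apply: transfer_dot c0 _ transfer.
  apply: lap_cprism_eigen gR0 gRE _ _.
    by rewrite eE rmorphD /=; lra.
  rewrite rmorphD /=; nra.
rewrite -!dotE; apply: transfer_dot c0 _ transfer.
apply: lap_cprism_eigen gR0 gRE _ _.
  by rewrite eE rmorphD /=; lra.
rewrite rmorphD /=; nra.
Qed.

(** The analogue of [family_transfer] for the eigenvalue [2]. *)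
Lemma side_transfer :
  exists b : bool,
   \sum_a y (inl a) - \sum_a y (inr a)
     = (-1) ^+ b * (\sum_a x (inl a) - \sum_a x (inr a)) /\
   (\sum_a x (inl a) - \sum_a x (inr a) = 0 \/
       cis (tau * 2) = (-1) ^+ b * gamma).
Proof.
have dotE (z : cprism G -> int) :
    \sum_w prism_fun (fun=> 1) (fun=> -1) w * (z w)%:~R
    = (\sum_a z (inl a) - \sum_a z (inr a))%:~R :> R.
  rewrite sum_cprism /= rmorphB !rmorph_sum -sumrN; congr (_ + _).
    by apply: eq_bigr => a _; rewrite mul1r.
  by apply: eq_bigr => a _; rewrite mulN1r.
have := transfer_dot c0 (@lap_cprism_const G R) transfer.
rewrite !dotE => E.
have /(congr1 Num.norm) := E.
rewrite !normrM norm_cis g1 !mul1r !normc_real => /complexI /esym /eqP.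
set p := _ - _ in E *; set q := _ - _ in E *.
rewrite -!intr_norm eqr_int eqr_norm2 => qp.
have [b hb] : exists b : bool, q = (-1) ^+ b * p.
  case/orP: qp => /eqP ->; [exists false|exists true].
    by rewrite mul1r.
  by rewrite mulN1r.
exists b; split=> //; have [->|p0] := eqVneq p 0; [by left|right].
have pC : (p%:~R)%:C != 0 :> R[i].
  by apply/eqP => /complexI/eqP; rewrite intr_eq0 (negPf p0).
apply: (mulIf pC); rewrite E hb rmorphM rmorphM !rmorph_sign /=; ring.
Qed.

End Phase.

(** All the eigenvectors not orthogonal to [x] carry the same sign, so [y = x]
    or [y = - x], against linear independence. *)
Theorem no_balanced_transfer (x y : cprism G -> int) (c : R) :
  c != 0 -> \sum_z x z = 0 -> \sum_z y z = 0 ->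
  ~ perfect_state_transfer (laplacian_mx R (cprism G))
      (c *: vertex_col (fun z => (x z)%:~R))
      (c *: vertex_col (fun z => (y z)%:~R)).
Proof.
move=> c0 x0 y0 [_ _ fr [tau [gamma [t0 g1 tr]]]].
have gamma0 : gamma != 0 by rewrite -normr_eq0 g1 oner_eq0.
(* the signs that the phases of the non-constant eigenvectors allow *)
pose realized b := (exists e : int, [/\ (2 %| e - S)%Z, e != 0 &
    signed_phases S tau gamma e b]) \/ cis (tau * 2) = (-1) ^+ b * gamma.
have S2 : 2 < S by [].
have unique b b' : realized b -> realized b' -> b = b'.
  case=> [[e [e2 e0 pe]]|p2] [[f [f2 f0 pf]]|q2].
  - apply: (signed_phases_agree t0 gamma0 _ pe pf).
    by move: e2 f2; lia.
  - by case: (signed_phases_irrational_conflict t0 S2 e0 pe q2).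
  - by case: (signed_phases_irrational_conflict t0 S2 f0 pf p2).
  - move: q2; rewrite p2 => /(mulIf gamma0) /eqP.
    by rewrite (inj_eq (@signr_inj _)) => /eqP.
have [b hb] : exists b, forall b', realized b' -> b' = b.
  have [rt|nrt] := pselect (realized true).
    by exists true => b' /unique; apply.
  by exists false => -[].
pose z w := y w - (-1) ^+ b * x w.
have zdot (g : G -> int) (i : G -> cprism G) :
    (exists b' : bool,
      \sum_a g a * y (i a) = (-1) ^+ b' * \sum_a g a * x (i a) /\
      (\sum_a g a * x (i a) = 0 \/ realized b')) ->
    \sum_a g a * z (i a) = 0.
  move=> [b' [e h]].
  have -> : \sum_a g a * z (i a)
      = \sum_a g a * y (i a) - (-1) ^+ b * \sum_a g a * x (i a).
    by rewrite mulr_sumr -sumrB; apply: eq_bigr => a _; rewrite /z; ring.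
  by rewrite e; case: h => [->|/hb ->]; rewrite ?mulr0 subrr.
have parE d : (2 %| 2 * d - S - S)%Z.
  by lia.
have step (p q : int) g d (b' : bool) : eigen_family g d ->
    (p = 0 /\ q = 0) \/ signed_phases S tau gamma (2 * d - S) b' ->
    (p = 0 \/ realized b') /\ (q = 0 \/ realized b').
  move=> gd [[-> ->]|h]; first by split; left.
  have : realized b'.
    left; exists (2 * d - S).
    by split=> //; rewrite subr_eq0 (family_not_half gd).
  by split; right.
have [c1 h1] : exists c1, forall a, z (inl a) = c1.
  apply: family_complete => g d gd; apply: zdot.
  have [b' [e1 _ h]] := family_transfer c0 g1 tr gd.
  by exists b'; split=> //; exact: (step _ _ _ _ _ gd h).1.
have [c2 h2] : exists c2, forall a, z (inr a) = c2.
  apply: family_complete => g d gd; apply: zdot.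
  have [b' [_ e1 h]] := family_transfer c0 g1 tr gd.
  by exists b'; split=> //; exact: (step _ _ _ _ _ gd h).2.
have sumz (i : G -> cprism G) k : (forall a, z (i a) = k) ->
    S * k = \sum_a y (i a) - (-1) ^+ b * \sum_a x (i a).
  move=> h; rewrite mulr_sumr -sumrB.
  rewrite (eq_bigr (fun=> k)) ?sumr_const; last first.
    by move=> a _; rewrite -(h a).
  by rewrite -mulr_natl natz.
have [b' [sE h]] := side_transfer c0 g1 tr.
have {}sE : \sum_a y (inl a) - \sum_a y (inr a)
     = (-1) ^+ b * (\sum_a x (inl a) - \sum_a x (inr a)).
  case: h => [h|h]; first by rewrite sE h !mulr0.
  by rewrite sE (hb b')//; right.
have k1 := sumz _ _ h1; have k2 := sumz _ _ h2.
move: x0 y0; rewrite !sum_cprism => x0 y0.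
(* pairing [z] with the constants and with the two-sided sign kills [c1] and
   [c2] *)
have [e1 e2] : c1 = 0 /\ c2 = 0.
  have S0 : S != 0 by rewrite gt_eqF// (lt_trans _ S2).
  have d0 : S * c1 - S * c2 = 0.
    by move/eqP: sE; rewrite -subr_eq0 => /eqP <-; rewrite k1 k2; ring.
  have s0 : S * c1 + S * c2 = 0.
    by rewrite k1 k2 addrACA -opprD -mulrDr x0 y0 mulr0 subr0.
  by split; apply: (mulfI S0); rewrite mulr0; lia.
have xy w : x w = (-1) ^+ b * y w.
  suff -> : y w = (-1) ^+ b * x w by rewrite mulrA -signr_addb addbb mul1r.
  apply/eqP; rewrite -subr_eq0 -/(z w).
  by case: w => a; rewrite ?h1 ?h2 ?e1 ?e2.
move: fr; set u := c *: vertex_col _ ; set v := c *: vertex_col _.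
have -> : u = (-1) ^+ b *: v.
  rewrite /u /v scalerA mulrC -scalerA; congr (_ *: _).
  by apply/matrixP => i j; rewrite !mxE xy rmorphM rmorph_sign.
rewrite free_cons => /andP[/negP + _]; apply.
by rewrite span_seq1 memvZ ?memv_line.
Qed.

End NoTransfer.

(** * Pair states *)

Section Pairs.
Variables (R : realType) (G : sgraph).

Definition pair_fun (V : pzRingType) (x y : G) (z : G) : V :=
  (z == x)%:R - (z == y)%:R.

Lemma sum_pair_fun (V : pzRingType) (f : G -> V) x y :
  \sum_z pair_fun V x y z * f z = f x - f y.
Proof.
have delta w : \sum_z (z == w)%:R * f z = f w.
  rewrite (bigD1 w)//= eqxx mul1r big1 ?addr0// => z zw.
  by rewrite (negPf zw) mul0r.
by under eq_bigr do rewrite mulrBl; rewrite sumrB !delta.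
Qed.

Lemma sum_pair_fun0 (V : pzRingType) x y : \sum_z pair_fun V x y z = 0.
Proof.
have := sum_pair_fun (fun=> 1 : V) x y; rewrite subrr => sE; rewrite -[RHS]sE.
by apply: eq_bigr => z _; rewrite mulr1.
Qed.

Lemma char_vec_pair x y :
  char_vec R x - char_vec R y = vertex_col (pair_fun R x y).
Proof. by apply/matrixP => i j; rewrite !mxE. Qed.

Lemma pair_fun_intr x y :
  vertex_col (pair_fun R x y) = vertex_col (fun z => (pair_fun int x y z)%:~R).
Proof. by apply/matrixP => i j; rewrite !mxE rmorphB !rmorph_nat. Qed.

Lemma pair_state_unit x y : x != y ->
  unit_vec ((Num.sqrt 2)^-1 *: vertex_col (pair_fun R x y)).
Proof.
move=> xy; rewrite /unit_vec.
transitivity (\sum_z 2^-1 * (pair_fun R x y z * pair_fun R x y z)).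
  rewrite sum_enum_val; apply: eq_bigr => k _.
  by rewrite !mxE exprMn exprVn sqr_sqrtr ?ler0n// expr2.
rewrite -mulr_sumr sum_pair_fun /pair_fun !eqxx (negPf xy) eq_sym (negPf xy).
by rewrite subr0 sub0r opprK mulVf.
Qed.

(** The vertex [x] lies outside the second pair, so the two states are not
    proportional. *)
Lemma pair_state_transfer_intro (tau : R) (gamma : R[i]) (x y x' y' : G) :
  x != y -> x' != y' -> x != x' -> x != y' -> 0 < tau -> `|gamma| = 1 ->
  transition_mx (laplacian_mx R G) tau
    *m to_complex_mx (vertex_col (pair_fun R x y))
    = gamma *: to_complex_mx (vertex_col (pair_fun R x' y')) ->
  perfect_pair_state_transfer (laplacian_mx R G).
Proof.
move=> xy xy' xx' xy'' t0 g1 T; set c : R := (Num.sqrt 2)^-1.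
have c0 : c != 0 by rewrite invr_eq0 sqrtr_eq0 -ltNge ltr0n.
exists (c *: vertex_col (pair_fun R x y)), (c *: vertex_col (pair_fun R x' y')).
split; [by exists x, y; rewrite char_vec_pair|
        by exists x', y'; rewrite char_vec_pair|].
split; [exact: pair_state_unit|exact: pair_state_unit| |]; last first.
  exists tau, gamma; split=> //.
  by rewrite /to_complex_mx !map_mxZ -scalemxAr T !scalerA mulrC.
rewrite free_cons seq1_free span_seq1; apply/andP; split.
  apply/negP => /vlineP[k /matrixP/(_ (enum_rank x) 0)].
  rewrite !mxE enum_rankK /pair_fun eqxx (negPf xy) (negPf xx') (negPf xy'').
  by rewrite !subr0 !mulr0 mulr1 => /eqP; rewrite (negPf c0).
rewrite scaler_eq0 negb_or c0 /=; apply/eqP => /matrixP/(_ (enum_rank x') 0).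
rewrite !mxE enum_rankK /pair_fun eqxx (negPf xy') subr0 => /eqP.
by rewrite oner_eq0.
Qed.

Lemma transition_vertex_eigen (t l : R) (f : G -> R) :
  (forall x, lap f x = l * f x) ->
  transition_mx (laplacian_mx R G) t *m to_complex_mx (vertex_col f)
    = cis (t * l) *: to_complex_mx (vertex_col f).
Proof.
move=> fl; apply: transition_mx_eigen.
by rewrite laplacian_mx_vertex_col; apply/matrixP => i j; rewrite !mxE fl.
Qed.

Lemma vertex_col_lin (a b : R) (f g : G -> R) :
  to_complex_mx (vertex_col (fun x => a * f x + b * g x))
  = a%:C *: to_complex_mx (vertex_col f) + b%:C *: to_complex_mx (vertex_col g).
Proof.
by apply/matrixP => i j; rewrite !mxE rmorphD !rmorphM.
Qed.

End Pairs.

(** * Transfer across the prism *)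

(** An eigenvalue [d = #|G| / 2] makes the two diagonal entries [d + 1] and
    [#|G| - d + 1] of the plane of [g] equal. *)
Section HalfEigenvalue.
Variables (R : realType) (G : sgraph) (g : G -> R) (d : R).
Hypothesis g0 : \sum_a g a = 0.
Hypothesis gd : forall a, lap g a = d * g a.
Hypothesis half : 2 * d = #|G|%:R.

(** The eigenvectors [(g, g)] and [(g, - g)] have eigenvalues [d] and [d + 2];
    at time [pi / 2] their phases are opposite. *)
Lemma half_eigenvalue_swap :
  transition_mx (laplacian_mx R (cprism G)) (pi / 2)
      *m to_complex_mx (vertex_col (prism_fun g (fun=> 0)))
  = cis (pi / 2 * d) *: to_complex_mx (vertex_col (prism_fun (fun=> 0) g)).
Proof.
have eigen_p : forall z, lap (prism_fun g (fun x => 1 * g x)) z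
    = d * prism_fun g (fun x => 1 * g x) z.
  by apply: lap_cprism_eigen => //; rewrite -?half; ring.
have eigen_m : forall z, lap (prism_fun g (fun x => -1 * g x)) z
    = (d + 2) * prism_fun g (fun x => -1 * g x) z.
  by apply: lap_cprism_eigen => //; rewrite -?half; ring.
have -> : prism_fun g (fun=> 0) =
    (fun z => 2^-1 * prism_fun g (fun x => 1 * g x) z
      + 2^-1 * prism_fun g (fun x => -1 * g x) z).
  by apply/funext => -[] a /=; lra.
have -> : prism_fun (fun=> 0) g =
    (fun z => 2^-1 * prism_fun g (fun x => 1 * g x) z
      + (- 2^-1) * prism_fun g (fun x => -1 * g x) z).
  by apply/funext => -[] a /=; lra.
rewrite !vertex_col_lin mulmxDr -!scalemxAr.
rewrite (transition_vertex_eigen _ eigen_p) (transition_vertex_eigen _ eigen_m).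
have -> : pi / 2 * (d + 2) = pi / 2 * d + pi by lra.
rewrite cisD cispi scalerDr !scalerA rmorphN; congr (_ *: _ + _ *: _); ring.
Qed.

End HalfEigenvalue.

(** * Complete bipartite graphs *)

Section CompleteBipartiteSpectrum.
Variables m n : nat.
Local Notation K := (complete_bipartite m n).

Definition bip_fun (V : Type) (f : 'I_m -> V) (g : 'I_n -> V) (x : K) : V :=
  match x with inl a => f a | inr b => g b end.

Lemma card_complete_bipartite : #|K| = (m + n)%N.
Proof. by rewrite card_sum !card_ord. Qed.

Lemma sum_bip (V : nmodType) (F : K -> V) :
  \sum_z F z = \sum_(a < m) F (inl a) + \sum_(b < n) F (inr b).
Proof. by rewrite big_sumType. Qed.

Lemma lap_bip_inl (V : pzRingType) (f : K -> V) (a : 'I_m) :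
  lap f (inl a) = n%:R * f (inl a) - \sum_b f (inr b).
Proof.
rewrite /lap sum_bip /= big1 ?add0r => [|b _]; last by rewrite mul0r.
under eq_bigr do rewrite mul1r.
by rewrite sumrB sumr_const card_ord mulr_natl.
Qed.

Lemma lap_bip_inr (V : pzRingType) (f : K -> V) (b : 'I_n) :
  lap f (inr b) = m%:R * f (inr b) - \sum_a f (inl a).
Proof.
rewrite /lap sum_bip /= addrC big1 ?add0r => [|a _]; last by rewrite mul0r.
under eq_bigr do rewrite mul1r.
by rewrite sumrB sumr_const card_ord mulr_natl.
Qed.

(** An integral family spanning the functions of sum zero on [K_{m,n}]: the
    differences within one side, and the balanced function constant on each
    side. *)
Inductive bip_eigen : (K -> int) -> int -> Prop :=
| BipLeft (a1 a2 : 'I_m) : bip_eigen (pair_fun int (inl a1 : K) (inl a2)) n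
| BipRight (b1 b2 : 'I_n) : bip_eigen (pair_fun int (inr b1 : K) (inr b2)) m
| BipSides : bip_eigen (bip_fun (fun=> n%:Z) (fun=> - m%:Z)) (m + n).

Lemma lap_pair_left (V : pzRingType) (a1 a2 : 'I_m) (x : K) :
  lap (pair_fun V (inl a1 : K) (inl a2)) x
  = n%:R * pair_fun V (inl a1 : K) (inl a2) x.
Proof.
have := sum_pair_fun0 V (inl a1 : K) (inl a2); rewrite sum_bip => s0.
have r0 b : pair_fun V (inl a1 : K) (inl a2) (inr b) = 0.
  by rewrite /pair_fun subrr.
move: s0; rewrite [X in _ + X]big1 ?addr0 // => s0.
case: x => [a|b]; first by rewrite lap_bip_inl big1 ?subr0.
by rewrite lap_bip_inr s0 r0 !mulr0 subr0.
Qed.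

Lemma lap_pair_right (V : pzRingType) (b1 b2 : 'I_n) (x : K) :
  lap (pair_fun V (inr b1 : K) (inr b2)) x
  = m%:R * pair_fun V (inr b1 : K) (inr b2) x.
Proof.
have := sum_pair_fun0 V (inr b1 : K) (inr b2); rewrite sum_bip => s0.
have r0 a : pair_fun V (inr b1 : K) (inr b2) (inl a) = 0.
  by rewrite /pair_fun subrr.
move: s0; rewrite big1 ?add0r // => s0.
case: x => [a|b]; last by rewrite lap_bip_inr big1 ?subr0.
by rewrite lap_bip_inl s0 r0 !mulr0 subr0.
Qed.

Lemma lap_sides (V : comPzRingType) (x : K) :
  lap (bip_fun (fun=> n%:R : V) (fun=> - m%:R)) x
  = (m%:R + n%:R) * bip_fun (fun=> n%:R : V) (fun=> - m%:R) x.
Proof.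
case: x => [a|b]; rewrite ?lap_bip_inl ?lap_bip_inr /= sumr_const card_ord.
  by rewrite -mulr_natl; ring.
by rewrite -mulr_natl; ring.
Qed.

Lemma bip_eigen_sum0 g d : bip_eigen g d -> \sum_x g x = 0.
Proof.
case=> [a1 a2|b1 b2|]; try exact: sum_pair_fun0.
rewrite sum_bip /= !sumr_const !card_ord -(mulr_natl _ m) -(mulr_natl _ n).
by rewrite !natz; lia.
Qed.

Lemma bip_eigenE g d : bip_eigen g d -> forall x, lap g x = d * g x.
Proof.
case=> [a1 a2|b1 b2|] x.
- by rewrite lap_pair_left natz.
- by rewrite lap_pair_right natz.
- by have := lap_sides int x; rewrite !natz.
Qed.

Lemma bip_eigen_complete (z : K -> int) : (0 < m)%N -> (0 < n)%N ->
  (forall g d, bip_eigen g d -> \sum_x g x * z x = 0) ->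
  exists c, forall x, z x = c.
Proof.
move=> m0 n0 ort; pose a0 := Ordinal m0; pose b0 := Ordinal n0.
have left a : z (inl a) = z (inl a0).
  by have := ort _ _ (BipLeft a a0); rewrite sum_pair_fun => /subr0_eq.
have right b : z (inr b) = z (inr b0).
  by have := ort _ _ (BipRight b b0); rewrite sum_pair_fun => /subr0_eq.
have sides : z (inr b0) = z (inl a0).
  have := ort _ _ BipSides; rewrite sum_bip /=.
  under eq_bigr do rewrite left; under [X in _ + X]eq_bigr do rewrite right.
  rewrite !sumr_const !card_ord -(mulr_natl _ m) -(mulr_natl _ n) !natz => E.
  have mn0 : (m%:Z * n%:Z) != 0 by rewrite mulf_neq0// gt_eqF.
  apply: (mulfI mn0); move: (z (inl a0)) (z (inr b0)) E => p q E.
  by apply/eqP; rewrite eq_sym -subr_eq0 -[X in _ == X]E; apply/eqP; ring.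
by exists (z (inl a0)) => -[a|b]; rewrite ?left ?right ?sides.
Qed.

End CompleteBipartiteSpectrum.

(** * Transfer in the prism of a complete bipartite graph *)

Lemma no_transfer_unbalanced (R : realType) (m n : nat) :
  (0 < m)%N -> (0 < n)%N -> m != n ->
  ~ perfect_pair_state_transfer
      (laplacian_mx R (cprism (complete_bipartite m n))).
Proof.
move=> m0 n0 mn [u [v [[x [y [_ ->]]] [x' [y' [_ ->]]]]]].
rewrite !char_vec_pair !pair_fun_intr.
apply: (no_balanced_transfer (@bip_eigen_sum0 m n) (@bip_eigenE m n));
  rewrite ?card_complete_bipartite ?sum_pair_fun0 ?invr_eq0 ?sqrtr_eq0;
  rewrite -?ltNge ?ltr0n//.
- by move=> g d [_ _|_ _|]; lia.
- by move=> z; apply: bip_eigen_complete.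
- by lia.
Qed.

Lemma transfer_balanced_large (R : realType) (n : nat) : (1 < n)%N ->
  perfect_pair_state_transfer
    (laplacian_mx R (cprism (complete_bipartite n n))).
Proof.
move=> n1; pose K := complete_bipartite n n.
pose a : K := inl (Ordinal (ltnW n1)); pose b : K := inl (Ordinal n1).
have ab : a != b by [].
apply: (@pair_state_transfer_intro R (cprism K) (pi / 2) (cis (pi / 2 * n%:R))
  (inl a) (inl b) (inr a) (inr b)) => //.
- by rewrite divr_gt0// pi_gt0.
- exact: norm_cis.
have -> : pair_fun R (inl a : cprism K) (inl b) =
    prism_fun (pair_fun R a b) (fun=> 0).
  by apply/funext => -[z|z] //=; rewrite /pair_fun /= subrr.
have -> : pair_fun R (inr a : cprism K) (inr b) =
    prism_fun (fun=> 0) (pair_fun R a b).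
  by apply/funext => -[z|z] //=; rewrite /pair_fun /= subrr.
apply: half_eigenvalue_swap.
- exact: sum_pair_fun0.
- exact: lap_pair_left.
- by rewrite card_complete_bipartite natrD; ring.
Qed.

(** One pair is the sum, and the other the difference, of an eigenfunction of
    eigenvalue [2] and of a combination of eigenfunctions of eigenvalues
    [2 +- sqrt 2]; at time [pi / sqrt 2] the latter two have the phase opposite
    to that of the former. *)
Lemma transfer_path4 (R : realType) :
  perfect_pair_state_transfer
    (laplacian_mx R (cprism (complete_bipartite 1 1))).
Proof.
pose K := complete_bipartite 1 1.
pose a : K := inl ord0; pose b : K := inr ord0.
set s : R := Num.sqrt 2.
have s2 : s * s = 2 by rewrite -expr2 sqr_sqrtr// ler0n.
have s0 : 0 < s by rewrite sqrtr_gt0 ltr0n.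
have sN0 := lt0r_neq0 s0.
pose t := pi / s; set z := cis (t * 2).
apply: (@pair_state_transfer_intro R (cprism K) t z
  (inl a) (inr a) (inl b) (inr b)) => //.
- by rewrite divr_gt0// pi_gt0.
- exact: norm_cis.
pose h : K -> R := bip_fun (fun=> 1) (fun=> -1).
pose f : cprism K -> R := prism_fun (fun=> 1) (fun=> -1).
pose w r : cprism K -> R := prism_fun h (fun x => r * h x).
have h0 : \sum_x h x = 0 by rewrite sum_bip /= !big_ord1 subrr.
have hE x : lap h x = 2 * h x.
  case: x => i; rewrite ?lap_bip_inl ?lap_bip_inr big_ord1 /=; ring.
have wE r : r * r = s * s ->
    forall x, lap (w (1 - r)) x = (2 + r) * w (1 - r) x.
  move=> rr; apply: lap_cprism_eigen h0 hE _ _; first by ring.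
  rewrite card_complete_bipartite natrD; lra.
have Up := transition_vertex_eigen t (wE s erefl).
have Um := transition_vertex_eigen t (wE (- s) (mulrNN s s)).
have Uf := transition_vertex_eigen t (@lap_cprism_const K R).
have zp : cis (t * (2 + s)) = - z.
  have -> : t * (2 + s) = t * 2 + pi by rewrite mulrDr divfK.
  by rewrite cisD cispi mulrN1.
have zm : cis (t * (2 - s)) = - z.
  apply: (mulIf (cis_neq0 pi)); rewrite -cisD cispi mulrN1 opprK.
  by congr cis; rewrite mulrBr divfK// subrK.
(* the weights [x] and [y] solve [x + y = 1 / 2] and [s (x - y) = 1], which
   makes [anti] half of the function [h] on the graph and [- h] on its copy *)
pose x := 4^-1 + s / 4; pose y := 4^-1 - s / 4.
pose anti u := x * w (1 - s) u + y * w (1 - - s) u.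
have antiE u : anti u = 2^-1 * prism_fun h (fun v => - h v) u.
  case: u => v; rewrite /anti /w /x /y /=; first by lra.
  by have := congr1 ( *%R^~ (h v)) s2 => /= s2h; lra.
have -> : pair_fun R (inl a : cprism K) (inr a)
    = fun u => 2^-1 * f u + 1 * anti u.
  by apply/funext => -[[] i|[] i];
    rewrite antiE /pair_fun (ord1 i) /= /f /h /=; lra.
have -> : pair_fun R (inl b : cprism K) (inr b)
    = fun u => 2^-1 * f u + (-1) * anti u.
  by apply/funext => -[[] i|[] i];
    rewrite antiE /pair_fun (ord1 i) /= /f /h /=; lra.
rewrite !vertex_col_lin !mulmxDr -!scalemxAr mulmxDr -!scalemxAr Uf Up Um zp zm.
rewrite !scalerDr !scalerA rmorphN !rmorph1 -/z.
by congr (_ *: _ + (_ *: _ + _ *: _)); ring.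
Qed.

Theorem theorem14 (R : realType) (m n : nat) (hm : (0 < m)%N) (hn : (0 < n)%N) :
  perfect_pair_state_transfer
    (laplacian_mx R (cprism (complete_bipartite m n))) <-> m = n.
Proof.
split=> [transfer | <-].
  by apply/eqP; apply: contraT => /(no_transfer_unbalanced hm hn)/(_ transfer).
have [m1 | m1] := ltnP 1 m; first exact: transfer_balanced_large.
have -> : m = 1%N by lia.
exact: transfer_path4.
Qed.
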